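(* Let $G$ be a finite, simple, connected graph with diameter $D(G)$, let $k \geq 3$ be an integer, and let $I_s, I_t$ be independent sets of $G$. Then $I_s \rightsquigarrow_k I_t$ if and only if $I_s \rightsquigarrow_{D(G)} I_t$.
   Context: For an integer $k \ge 1$ and independent sets $I, J$ of a graph $G$, write $I \leftrightarrow_k J$ if $|I \setminus J| = |J \setminus I| = 1$ and $\mathrm{dist}_G(u,v) \le k$, where $I \setminus J = \{u\}$ and $J \setminus I = \{v\}$; one such step is a move of the token on $u$ to $v$ (the $k$-Jump model). Write $I \rightsquigarrow_k J$ if there is a finite sequence $I = I_0, I_1, \dots, I_\ell = J$ ($\ell \ge 0$) of independent sets of $G$ with $I_j \leftrightarrow_k I_{j+1}$ for all $0 \le j < \ell$. The case $k = D(G)$ is the Token Jumping model. *)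

(* Defs.v *)
From mathcomp Require Import all_boot.

Set Implicit Arguments.
Unset Strict Implicit.
Unset Printing Implicit Defensive.

(* A finite simple graph is a symmetric irreflexive relation
   e : rel T on a finite type T of vertices. *)

Definition connected_graph (T : finType) (e : rel T) : Prop :=
  forall x y : T, connect e x y.

Definition walk_of_length (T : finType) (e : rel T) (n : nat) (x y : T) : bool :=
  [exists p : n.-tuple T, path e x p && (last x p == y)].

(* A shortest path visits each vertex at most once, so its length is < #|T|;
   hence the search range.  The value is #|T| if no walk joins x to y, which
   does not occur in a connected graph; see dist_walk and dist_min. *)
Definition dist (T : finType) (e : rel T) (x y : T) : nat :=
  find (fun n => walk_of_length e n x y) (iota 0 #|T|).

Definition diameter (T : finType) (e : rel T) : nat :=
  \max_(x : T) \max_(y : T) dist e x y.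

Definition independent (T : finType) (e : rel T) (I : {set T}) : bool :=
  [forall x in I, forall y in I, ~~ e x y].

Definition kjump (T : finType) (e : rel T) (k : nat) : rel {set T} :=
  fun I J => [exists u, exists v,
    [&& I :\: J == [set u], J :\: I == [set v] & dist e u v <= k]].

(* I :: p is the sequence I_0, ..., I_l, with l = size p. *)
Definition kreachable (T : finType) (e : rel T) (k : nat) (I J : {set T}) : Prop :=
  exists p : seq {set T},
    [/\ all (independent e) (I :: p), path (kjump e k) I p & last I p = J].

Lemma walk_of_lengthP (T : finType) (e : rel T) n (x y : T) :
  reflect (exists p, [/\ path e x p, last x p = y & size p = n])
          (walk_of_length e n x y).
Proof.
apply: (iffP existsP) => [[p /andP[ep /eqP lp]]|[p [ep lp /eqP sp]]].
  by exists p; rewrite size_tuple.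
by exists (Tuple sp); rewrite /= ep lp eqxx.
Qed.

Lemma dist_walk (T : finType) (e : rel T) (x y : T) :
  connect e x y -> walk_of_length e (dist e x y) x y.
Proof.
case/connectP=> p0 /shortenP[p ep up _] ly.
have szp : size p < #|T| by rewrite -[_.+1]/(size (x :: p)) -(card_uniqP up) max_card.
have hs : has (fun n => walk_of_length e n x y) (iota 0 #|T|).
  apply/hasP; exists (size p); first by rewrite mem_iota.
  by apply/walk_of_lengthP; exists p.
have := nth_find 0 hs; rewrite nth_iota ?add0n //.
by move: hs; rewrite has_find size_iota.
Qed.

Lemma dist_min (T : finType) (e : rel T) (x y : T) (p : seq T) :
  path e x p -> last x p = y -> dist e x y <= size p.
Proof.
move=> ep lp; rewrite leqNgt; apply/negP=> lt_p.
have lt_n : size p < #|T|.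
  by apply: leq_trans lt_p _; rewrite -[leqRHS](size_iota 0) find_size.
have := before_find 0 lt_p; rewrite nth_iota // add0n => /walk_of_lengthP[].
by exists p.
Qed.

(* Main.v *)
(* It suffices to simulate one jump, from u |: K to v |: K, by jumps of length at most 3,
   by induction on d = dist u v.  If d > 3, let x be the second inner vertex of a shortest
   path from u to v.  If some token w of K is equal or adjacent to x, then w is at distance
   less than d from both u and v: jump w to v, then u to w.  Otherwise x is free: jump u to
   x, then x to v. *)
Require Import Defs.
From mathcomp Require Import all_boot.

Section Reachability.
Variables (T : finType) (e : rel T).
Implicit Types (I J K L : {set T}) (u v w x : T).

Lemma dist_le_diameter u v : dist e u v <= diameter e.
Proof.
apply: leq_trans (leq_bigmax u).
exact: (leq_bigmax (F := fun y => dist e u y) v).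
Qed.

Lemma kreachable_refl k I : independent e I -> kreachable e k I I.
Proof. by move=> iI; exists [::]; rewrite /= iI. Qed.

Lemma kreachable_trans k J I L :
  kreachable e k I J -> kreachable e k J L -> kreachable e k I L.
Proof.
move=> [p [/= /andP[iI ip] pp <-]] [q [/= /andP[_ iq] pq lq]].
by exists (p ++ q); rewrite /= iI all_cat ip iq cat_path pp pq last_cat.
Qed.

(** Reduces each direction of the theorem to single jumps: the sequences that simulate consecutive
    jumps are concatenated. The simulation may use that both ends of a jump are independent, as
    every member of a reachability sequence is. *)
Lemma kreachable_sub k m I J :
    (forall A B, independent e A -> independent e B ->
       kjump e k A B -> kreachable e m A B) ->
  kreachable e k I J -> kreachable e m I J.
Proof.
move=> km [p]; elim: p I => [|A p IHp] I [/= /andP[iI iA] pp lp].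
  by rewrite -lp; apply: kreachable_refl.
case/andP: pp => IA pA; case/andP: (iA) => indA _.
by apply: (@kreachable_trans _ A); [apply: km | apply: IHp].
Qed.

Lemma setU1D_swap u v K : u != v -> u \notin K -> (u |: K) :\: (v |: K) = [set u].
Proof.
move=> uv uK; apply/setP=> z; rewrite !inE.
have [->|_] := eqVneq z u; first by rewrite (negPf uv) (negPf uK).
by case: (z \in K); rewrite ?orbT ?andbF.
Qed.

(** The case [u = v] is covered by the empty sequence, so no caller has to prove its endpoints
    distinct. *)
Lemma kreachable_jump k u v K :
    dist e u v <= k -> u \notin K -> v \notin K ->
    independent e (u |: K) -> independent e (v |: K) ->
  kreachable e k (u |: K) (v |: K).
Proof.
move=> duv uK vK iu iv; have [<-|uv] := eqVneq u v; first exact: kreachable_refl.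
exists [:: v |: K]; rewrite /= iu iv !andbT; split=> //.
apply/existsP; exists u; apply/existsP; exists v.
have vu : v != u by rewrite eq_sym.
by rewrite !setU1D_swap // !eqxx.
Qed.

(** The tokens that stay put, [I :&: J], serve as [K]. *)
Lemma kjumpP k I J :
  kjump e k I J ->
  exists u v K, [/\ dist e u v <= k, u \notin K, v \notin K, I = u |: K & J = v |: K].
Proof.
case/existsP=> u /existsP[v /and3P[/eqP Eu /eqP Ev duv]].
exists u, v, (I :&: J); split=> //.
- by have := set11 u; rewrite -Eu !inE; case: (u \in J); rewrite ?andbF.
- by have := set11 v; rewrite -Ev !inE; case: (v \in I).
- by rewrite -Eu setUC setID.
- by rewrite -Ev setIC setUC setID.
Qed.

Lemma independentP I :
  reflect {in I &, forall x y, ~~ e x y} (independent e I).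
Proof.
apply: (iffP forall_inP) => [H x y xI yI | H x xI].
  exact: (forall_inP (H x xI)).
by apply/forall_inP => y yI; apply: H.
Qed.

Hypotheses (e_sym : symmetric e) (e_irr : irreflexive e).

Lemma independentU1 x I :
  independent e (x |: I) = independent e I && [forall w in I, ~~ e x w].
Proof.
apply/idP/andP=> [/independentP H | [/independentP H /forall_inP xI]].
  split; first by apply/independentP => y z yI zI; apply: H; rewrite !inE ?yI ?zI orbT.
  by apply/forall_inP => w wI; apply: H; rewrite !inE ?eqxx // wI orbT.
apply/independentP => y z /setU1P[->|yI] /setU1P[->|zI]; first by rewrite e_irr.
- exact: xI.
- by rewrite e_sym xI.
- exact: H.
Qed.

Lemma dist_adj u v : e u v -> dist e u v <= 1.
Proof. by move=> uv; apply: (@dist_min _ _ _ _ [:: v]); rewrite //= uv. Qed.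

Hypothesis e_conn : connected_graph e.

Lemma kreachable_any k u v K :
    3 <= k -> u \notin K -> v \notin K ->
    independent e (u |: K) -> independent e (v |: K) ->
  kreachable e k (u |: K) (v |: K).
Proof.
move=> k3; move: {2}(dist e u v) (leqnn (dist e u v)) => n.
elim: n u v K => [|n IHn] u v K dn uK vK iu iv.
  by apply: kreachable_jump => //; apply: leq_trans dn _.
have [d3|d3] := leqP (dist e u v) 3.
  by apply: kreachable_jump => //; apply: leq_trans d3 k3.
(* The rest [L] is arbitrary: when [x] is blocked, the tokens that stay put are no longer [K]. *)
have {}IHn a b L : dist e a b < dist e u v -> a \notin L -> b \notin L ->
    independent e (a |: L) -> independent e (b |: L) ->
    kreachable e k (a |: L) (b |: L).
  by move=> ab; apply: IHn; rewrite -ltnS (leq_trans ab).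
have /walk_of_lengthP[p [pp lp sp]] := dist_walk (e_conn u v).
(* From here on [dist u v] is [size p + 2], where [p] leads from [x] to [v]. *)
case: p pp lp sp => [|x1 [|x p]] /=; try by move=> _ _ dE; rewrite -dE in d3.
move=> /and3P[ux1 x1x xp] lp sp.
have dux : dist e u x <= 2.
  by apply: (@dist_min _ _ _ _ [:: x1; x]); rewrite //= ux1 x1x.
have dxv : dist e x v <= size p by apply: dist_min xp lp.
have [/existsP[w /andP[wK wx]]|/existsPn free] :=
  boolP [exists w, (w \in K) && ((w == x) || e w x)].
  (* Going from [x] to [w] costs at most one edge, giving at most 2 + 1 from [u] and [size p + 1] to
     [v]. Both are less than [dist u v], the first precisely because that distance exceeds 3. *)
  have [duw dwv] : dist e u w <= 3 /\ dist e w v <= (size p).+1.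
    case/orP: wx => [/eqP->|wx]; first by split; apply: leqW.
    split.
      by apply: (@dist_min _ _ _ _ [:: x1; x; w]); rewrite //= ux1 x1x e_sym wx.
    by apply: (@dist_min _ _ _ _ (x :: p)); rewrite //= wx xp.
  have uw : u != w by apply: contraNneq uK => ->.
  have vw : v != w by apply: contraNneq vK => ->.
  have uv : ~~ e u v by apply: contraL d3 => /dist_adj d1; rewrite -leqNgt (leq_trans d1).
  have vu : v != u.
    apply: contraTneq d3 => ->; rewrite -leqNgt.
    by apply: leq_trans (@dist_min _ _ u u [::] isT erefl) _.
  have EK : K = w |: K :\ w by rewrite setD1K.
  (* Between the two jumps both [u] and [v] carry tokens and [w] is empty. The only new pair is [u],
     [v], which is too far apart to be adjacent. *)
  have iuv : independent e (v |: (u |: K :\ w)).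
    move: iu iv; rewrite !independentU1 => /andP[iK /forall_inP Ku] /andP[_ /forall_inP Kv].
    rewrite -!andbA; apply/and3P; split.
    - by move: iK; rewrite {1}EK independentU1 => /andP[].
    - by apply/forall_inP=> z /setD1P[_ /Ku].
    - by apply/forall_inP=> z /setU1P[->|/setD1P[_ /Kv] //]; rewrite e_sym.
  (* These expose [w] as the moving token: it leaves with rest [u |: K :\ w], and is replaced from
     [u] with rest [v |: K :\ w]. *)
  have Eu : u |: K = w |: (u |: K :\ w) by rewrite setUCA -EK.
  have Ev : v |: K = w |: (v |: K :\ w) by rewrite setUCA -EK.
  apply: (@kreachable_trans _ (v |: (u |: K :\ w))).
    rewrite Eu; apply: IHn; rewrite -?Eu // ?inE ?eqxx ?orbF.
    - by rewrite -sp.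
    - by rewrite eq_sym.
    - by rewrite negb_or vu (negPf vK) andbF.
  rewrite setUCA Ev; apply: IHn; rewrite -?Ev // ?inE ?eqxx ?orbF.
  - exact: leq_ltn_trans d3.
  - by rewrite eq_sym negb_or vu (negPf uK) andbF.
  - by rewrite eq_sym.
  - by rewrite setUCA.
have xK : x \notin K by have := free x; rewrite eqxx andbT.
have ix : independent e (x |: K).
  move: iu; rewrite !independentU1 => /andP[-> _] /=.
  by apply/forall_inP=> w wK; have := free w; rewrite wK e_sym /= negb_or => /andP[].
(* The two jumps have lengths at most 2 and [size p], both below [dist u v]. *)
apply: (@kreachable_trans _ (x |: K)); apply: IHn => //.
- by apply: leq_ltn_trans dux (ltn_trans _ d3).
- by rewrite -sp ltnS leqW.
Qed.

End Reachability.

Theorem theorem1 (T : finType) (e : rel T)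
    (e_sym : symmetric e) (e_irr : irreflexive e) (e_conn : connected_graph e)
    (k : nat) (hk : 3 <= k) (Is It : {set T})
    (indep_s : independent e Is) (indep_t : independent e It) :
  kreachable e k Is It <-> kreachable e (diameter e) Is It.
Proof.
split; apply: kreachable_sub => A B iA iB /kjumpP[u [v [K [duv uK vK EA EB]]]];
  rewrite {}EA {}EB in iA iB *.
  (* The same jump works even if [k] exceeds the diameter, which bounds every distance. *)
  by apply: kreachable_jump => //; apply: dist_le_diameter.
exact: kreachable_any.
Qed.
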